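(* There exist a Markov Paging instance, a horizon $T$, and a dominating distribution algorithm $\mathcal{A}_{\mathrm{dom}}$ such that $$\mathbb{E}[\mathrm{cost}(\mathcal{A}_{\mathrm{dom}},T)]\ge 1.5907\cdot \mathbb{E}[\mathrm{cost}(\mathrm{OPT},T)].$$
   Context: Markov Paging model: there are $n$ pages and a cache of size $k$. Page requests are drawn from a time-homogeneous Markov chain on the $n$ pages with some initial distribution and known transition matrix $M$ ($M_{i,j}$ = probability that page $j$ is requested next given page $i$ was most recently requested). The algorithm knows $M$ but not the realized sequence. All algorithms start from the same initial cache of $k$ pages. On a request to a page not in the cache, the algorithm suffers a cache miss (unit cost) and must evict a page from its cache to bring in the requested page. $\mathrm{cost}(\mathcal{A},T)$ is the number of cache misses among the first $T$ requests; expectations are over the request sequence and the algorithm's randomness. $\mathrm{OPT}$ is the online policy (not knowing the realized sequence) minimizing the expected cost. Dominating distribution algorithm: for pages $p\neq q$ and a page $s$, let $\alpha(p<q\mid s)$ be the probability that $p$ is next requested before $q$ given that $s$ is the most recently requested page; $\alpha(p<p\mid s)=0$. Whenever the algorithm suffers a cache miss on a request to $s$, it chooses a distribution $\mu$ over the pages currently in its cache such that for every page $q$ in the cache, $\sum_{p\text{ in cache}}\mu(p)\,\alpha(p<q\mid s)\le\tfrac12$, draws $p\sim\mu$ and evicts $p$. Any algorithm following this rule, with any valid choice of $\mu$, is a dominating distribution algorithm. *)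

(* Defs.v *)
From mathcomp Require Import all_boot all_order all_algebra.
From mathcomp Require Import all_classical all_reals all_analysis.

Set Implicit Arguments.
Unset Strict Implicit.
Unset Printing Implicit Defensive.

Import Order.TTheory GRing.Theory Num.Theory.
Import numFieldNormedType.Exports.

Local Open Scope ring_scope.

Definition distr_on (R : realType) (n : nat) (C : {set 'I_n}) (mu : 'I_n -> R)
    : Prop :=
  [/\ forall p, 0 <= mu p, forall p, p \notin C -> mu p = 0
    & \sum_(p in C) mu p = 1].

Record markov_paging (R : realType) (n k : nat) := MarkovPaging {
  mp_init : 'I_n -> R;
  mp_trans : 'M[R]_n;
  mp_cache0 : {set 'I_n};
  mp_initP : distr_on [set: 'I_n] mp_init;
  mp_transP : forall i, distr_on [set: 'I_n] (mp_trans i);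
  mp_k_gt0 : (0 < k)%N;
  mp_cache0P : #|mp_cache0| = k }.

(* Past of a run: the pairs (cache before the request, request), oldest first;
   consecutive caches determine the pages evicted so far. *)
Definition history (n : nat) := seq ({set 'I_n} * 'I_n).

(* [evict h C s p] is the probability of evicting p on a miss at s with cache C
   after the past h. Letting this distribution depend on h makes the type cover
   every randomized online algorithm; its values on hits and on sets that are
   not caches of size k are never used. *)
Record online_alg (R : realType) (n k : nat) := OnlineAlg {
  evict :> history n -> {set 'I_n} -> 'I_n -> 'I_n -> R;
  evictP : forall (h : history n) (C : {set 'I_n}) (s : 'I_n),
    #|C| = k -> s \notin C -> distr_on C (evict h C s) }.

(* Probability that the chain, being at s, continues along w. *)
Fixpoint path_prob (R : realType) (n : nat) (M : 'M[R]_n) (s : 'I_n)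
    (w : seq 'I_n) : R :=
  if w is x :: w' then M s x * path_prob M x w' else 1.

Definition request_prob (R : realType) (n k : nat) (I : markov_paging R n k)
    (w : seq 'I_n) : R :=
  if w is s :: w' then mp_init I s * path_prob (mp_trans I) s w' else 1.

(* Probability that the cache C becomes C' when s is requested. *)
Definition step_prob (R : realType) (n k : nat) (A : online_alg R n k)
    (h : history n) (C : {set 'I_n}) (s : 'I_n) (C' : {set 'I_n}) : R :=
  if s \in C then (C' == C)%:R
  else \sum_(p in C) A h C s p * (C' == s |: (C :\ p))%:R.

(* A run is a sequence of pairs (request, cache after serving it). [cache_prob]
   is the probability of its caches conditionally on its requests. *)
Fixpoint cache_prob (R : realType) (n k : nat) (A : online_alg R n k)
    (h : history n) (C : {set 'I_n}) (w : seq ('I_n * {set 'I_n})) : R :=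
  if w is (s, C') :: w'
  then step_prob A h C s C' * cache_prob A (rcons h (C, s)) C' w'
  else 1.

Fixpoint misses (n : nat) (C : {set 'I_n}) (w : seq ('I_n * {set 'I_n})) : nat :=
  if w is (s, C') :: w' then ((s \notin C) + misses C' w')%N else 0%N.

Definition expected_cost (R : realType) (n k : nat) (I : markov_paging R n k)
    (A : online_alg R n k) (T : nat) : R :=
  \sum_(w : T.-tuple ('I_n * {set 'I_n}))
    request_prob I (map fst w) * cache_prob A [::] (mp_cache0 I) w
    * (misses (mp_cache0 I) w)%:R.

Definition is_opt (R : realType) (n k : nat) (I : markov_paging R n k) (T : nat)
    (A : online_alg R n k) : Prop :=
  forall B : online_alg R n k, expected_cost I A T <= expected_cost I B T.

(* The t-th term is the probability, the last request being s, that the next t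
   requests avoid p and q and the one after them is p. The sum thus includes the
   case where p is requested and q never is. *)
Definition alpha (R : realType) (n k : nat) (I : markov_paging R n k)
    (p q s : 'I_n) : R :=
  if p == q then 0
  else limn (series (fun t : nat =>
         \sum_(w : t.-tuple 'I_n | all (fun x => (x != p) && (x != q)) w)
           path_prob (mp_trans I) s (rcons w p))).

Definition dominating (R : realType) (n k : nat) (I : markov_paging R n k)
    (A : online_alg R n k) : Prop :=
  forall (h : history n) (C : {set 'I_n}) (s : 'I_n),
    #|C| = k -> s \notin C ->
    forall q, q \in C -> \sum_(p in C) A h C s p * alpha I p q s <= 1 / 2.

(* Main.v *)
(* Take three pages, a cache of size 2, and the chain that alternates between
   pages 0 and 1. Page 2 is never requested. The initial cache is {1, 2} and the
   first request is 0. Evicting page 2 leads to a single miss, so the optimal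
   cost is 1. With two pages in the cache, evicting either one with probability
   1/2 is always dominating, because alpha is a probability. This rule keeps the
   page 2 with probability 1/2 at each miss and then misses again, so that over
   three requests it pays at least 1 + 1/2 + 1/4 = 7/4. *)
Require Import Defs.
From mathcomp Require Import all_boot all_order all_algebra.
From mathcomp Require Import all_classical all_reals all_analysis.
From mathcomp Require Import ring lra.

Set Implicit Arguments.
Unset Strict Implicit.
Unset Printing Implicit Defensive.

Import Order.TTheory GRing.Theory Num.Theory.

Local Open Scope ring_scope.

(** * Sums over tuples, unfolded at the first entry *)

Lemma sum_tupleS (V : nmodType) (T : finType) (t : nat) (F : seq T -> V) :
  \sum_(w : t.+1.-tuple T) F w = \sum_(x : T) \sum_(w : t.-tuple T) F (x :: w).
Proof.
rewrite pair_big /=.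
rewrite (reindex (fun xw : T * t.-tuple T => [tuple of xw.1 :: xw.2])) //=.
exists (fun w => (thead w, [tuple of behead w])) => [[x w] _ | w _] /=.
  by congr pair; apply: val_inj.
by apply: val_inj; rewrite /= [in RHS](tuple_eta w).
Qed.

Lemma sum_tuple0 (V : nmodType) (T : finType) (F : seq T -> V) :
  \sum_(w : 0.-tuple T) F w = F [::].
Proof.
by rewrite (big_pred1 [tuple]) // => w; apply/esym/eqP; exact: tuple0.
Qed.

(** * [alpha] is at most 1 *)

Section Alpha.
Context {R : realType} {n k : nat} (I : markov_paging R n k).
Local Notation M := (mp_trans I).
Implicit Types p q s x : 'I_n.

Lemma trans_ge0 s x : 0 <= M s x.
Proof. by have [] := mp_transP I s. Qed.

Lemma sum_trans s : \sum_x M s x = 1.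
Proof.
have [_ _ <-] := mp_transP I s.
by apply: eq_bigl => x; rewrite inE.
Qed.

Lemma path_prob_ge0 s w : 0 <= path_prob M s w.
Proof.
by elim: w s => [|x w IH] s //=; rewrite mulr_ge0 ?trans_ge0.
Qed.

Let first_visit p q s t : R :=
  \sum_(w : t.-tuple 'I_n | all (fun x => (x != p) && (x != q)) w)
    path_prob M s (rcons w p).

Let first_visit0 p q s : first_visit p q s 0 = M s p.
Proof.
rewrite /first_visit big_mkcond.
rewrite (sum_tuple0 (fun w => if all (fun x => (x != p) && (x != q)) w
   then path_prob M s (rcons w p) else 0)) /=.
by rewrite mulr1.
Qed.

Let first_visitS p q s t :
  first_visit p q s t.+1 =
  \sum_(x | (x != p) && (x != q)) M s x * first_visit p q x t.
Proof.
rewrite /first_visit big_mkcond.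
rewrite (sum_tupleS _ (fun w => if all (fun x => (x != p) && (x != q)) w
   then path_prob M s (rcons w p) else 0)) /=.
rewrite [RHS]big_mkcond; apply: eq_bigr => x _ /=.
case: ifP => _ /=; last by rewrite big1.
rewrite [in RHS]big_mkcond mulr_sumr; apply: eq_bigr => w _.
by case: ifP; rewrite ?mulr0.
Qed.

(** The events for different t are disjoint. The induction conditions on the next request x: p gives
    [M s p], q gives nothing, and any other x gives at most [M s x] by induction. *)
Let sum_first_visit_le1 p q s N : \sum_(t < N) first_visit p q s t <= 1.
Proof.
elim: N s => [|N IH] s; first by rewrite big_ord0.
rewrite big_ord_recl first_visit0 -(sum_trans s) (bigD1 p) //= lerD2l.
under eq_bigr do rewrite first_visitS.
rewrite exchange_big [leRHS]big_mkcond [leLHS]big_mkcond; apply: ler_sum => x _.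
case: (x != p) => //=; case: (x != q); last exact: trans_ge0.
by rewrite -mulr_sumr ler_piMr ?trans_ge0.
Qed.

Lemma alpha_le1 p q s : alpha I p q s <= 1.
Proof.
rewrite /alpha; case: eqP => // _.
have bnd N : series (first_visit p q s) N <= 1.
  by rewrite /series /= big_mkord sum_first_visit_le1.
apply: limr_le; last by apply: nearW.
(* The limit bound requires convergence: the partial sums increase and stay below 1. *)
apply: nondecreasing_is_cvgn; last by exists 1 => _ [N _ <-]; exact: bnd.
apply/nondecreasing_seqP => N; rewrite /series /= big_nat_recr //= lerDl.
by apply: sumr_ge0 => w _; exact: path_prob_ge0.
Qed.

End Alpha.

(** * One-step recursion for the expected cost *)

Section Cost.
Context {R : realType} {n k : nat} (I : markov_paging R n k).
Local Notation M := (mp_trans I).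
Implicit Types (A : online_alg R n k) (h : history n) (C : {set 'I_n}).
Implicit Types (s x : 'I_n) (t : nat).

(** The cost still to come when s was the last request. The past h stays a parameter because
    evictions may depend on it. *)
Definition cost_from A h C s t : R :=
  \sum_(w : t.-tuple ('I_n * {set 'I_n}))
    path_prob M s (map fst w) * cache_prob A h C w * (misses C w)%:R.

(** An initial distribution equal to row s of the chain acts as a fictitious request to s before the
    run, so the first request needs no separate treatment. *)
Lemma expected_cost_from A s t :
  mp_init I =1 M s -> expected_cost I A t = cost_from A [::] (mp_cache0 I) s t.
Proof.
move=> initE; apply: eq_bigr => w _; congr (_ * _ * _).
by case: (map fst w) => //= x v; rewrite initE.
Qed.

Lemma sum_step_hit A h C s (F : {set 'I_n} -> R) :
  s \in C -> \sum_C' step_prob A h C s C' * F C' = F C.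
Proof.
move=> sC; rewrite /step_prob sC (bigD1 C) //= eqxx mul1r big1 ?addr0 //.
by move=> C' /negPf ->; rewrite mul0r.
Qed.

Lemma sum_step_miss A h C s (F : {set 'I_n} -> R) :
  s \notin C -> \sum_C' step_prob A h C s C' * F C' =
                \sum_(p in C) A h C s p * F (s |: (C :\ p)).
Proof.
move=> /negPf sC; rewrite /step_prob sC.
under eq_bigr do rewrite mulr_suml.
rewrite exchange_big; apply: eq_bigr => p _.
rewrite (bigD1 (s |: (C :\ p))) //= eqxx mulr1 big1 ?addr0 //.
by move=> C' /negPf ->; rewrite mulr0 mul0r.
Qed.

Lemma card_swap C s p : s \notin C -> p \in C -> #|s |: (C :\ p)| = #|C|.
Proof.
move=> sC pC; rewrite cardsU1 !inE (negPf sC) andbF /=.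
by rewrite (cardsD1 p C) pC.
Qed.

(** A step from a cache of size k only reaches caches of size k, the only ones on which [evictP]
    constrains the algorithm. *)
Lemma eq_sum_step A h C s (F G : {set 'I_n} -> R) :
  #|C| = k -> (forall C', #|C'| = k -> F C' = G C') ->
  \sum_C' step_prob A h C s C' * F C' = \sum_C' step_prob A h C s C' * G C'.
Proof.
move=> Ck FG; have [sC|sC] := boolP (s \in C).
  by rewrite !sum_step_hit ?FG.
rewrite !sum_step_miss //; apply: eq_bigr => p pC.
by rewrite FG ?card_swap.
Qed.

Lemma sum_step A h C s : #|C| = k -> \sum_C' step_prob A h C s C' = 1.
Proof.
move=> Ck; under eq_bigr do rewrite -[step_prob _ _ _ _ _]mulr1.
have [sC|sC] := boolP (s \in C); first by rewrite (sum_step_hit _ _ (fun=> 1)).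
rewrite (sum_step_miss _ _ (fun=> 1)) //.
have [_ _ sumA] := evictP A h Ck sC.
by rewrite -[RHS]sumA; apply: eq_bigr => p _; rewrite mulr1.
Qed.

Lemma sum_run_prob A h C s t : #|C| = k ->
  \sum_(w : t.-tuple ('I_n * {set 'I_n}))
    path_prob M s (map fst w) * cache_prob A h C w = 1.
Proof.
elim: t h C s => [|t IH] h C s Ck.
  by rewrite (sum_tuple0 (fun w => path_prob M s (map fst w)
    * cache_prob A h C w)) /= mulr1.
rewrite (sum_tupleS _ (fun w => path_prob M s (map fst w)
    * cache_prob A h C w)) /= -(sum_trans I s).
transitivity (\sum_x \sum_C' M s x * (step_prob A h C x C' *
   \sum_(w : t.-tuple ('I_n * {set 'I_n}))
      path_prob M x (map fst w) * cache_prob A (rcons h (C, x)) C' w)).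
  rewrite [RHS]pair_big; apply: eq_bigr => -[x C'] _ /=.
  rewrite mulrA mulr_sumr; apply: eq_bigr => w _.
  by rewrite mulrACA.
apply: eq_bigr => x _; rewrite -mulr_sumr.
rewrite (eq_sum_step _ _ _ (G := fun=> 1) Ck); last by move=> *; exact: IH.
under eq_bigr do rewrite mulr1.
by rewrite sum_step ?mulr1.
Qed.

Lemma cost_from0 A h C s : cost_from A h C s 0 = 0.
Proof.
rewrite /cost_from (sum_tuple0 (fun w => path_prob M s (map fst w)
    * cache_prob A h C w * (misses C w)%:R)) /=.
by rewrite mulr0.
Qed.

(** Bellman recursion: condition on the next request and on the cache after it. *)
Lemma cost_fromS A h C s t : #|C| = k ->
  cost_from A h C s t.+1 = \sum_x M s x * ((x \notin C)%:R +
    \sum_C' step_prob A h C x C' * cost_from A (rcons h (C, x)) C' x t).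
Proof.
move=> Ck.
rewrite /cost_from (sum_tupleS _ (fun w => path_prob M s (map fst w)
    * cache_prob A h C w * (misses C w)%:R)) /=.
(* The miss at x is common to all continuations, so it multiplies their total probability, which
   [sum_run_prob] shows to be 1. *)
transitivity (\sum_x \sum_C' M s x * (step_prob A h C x C' *
   ((x \notin C)%:R * (\sum_(w : t.-tuple ('I_n * {set 'I_n}))
      path_prob M x (map fst w) * cache_prob A (rcons h (C, x)) C' w) +
   cost_from A (rcons h (C, x)) C' x t))).
  rewrite [RHS]pair_big; apply: eq_bigr => -[x C'] _ /=.
  rewrite mulrA mulr_sumr -big_split mulr_sumr; apply: eq_bigr => w _ /=.
  by rewrite natrD; ring.
apply: eq_bigr => x _; rewrite -mulr_sumr; congr (_ * _).
rewrite (eq_sum_step _ _ _ (G := fun C' =>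
   (x \notin C)%:R + cost_from A (rcons h (C, x)) C' x t) Ck); last first.
  by move=> C' C'k; rewrite sum_run_prob ?mulr1.
under [LHS]eq_bigr do rewrite mulrDr.
by rewrite big_split -mulr_suml sum_step ?mul1r.
Qed.

Lemma step_prob_ge0 A h C s C' : #|C| = k -> 0 <= step_prob A h C s C'.
Proof.
move=> Ck; rewrite /step_prob; case: ifPn => sC; first exact: ler0n.
have [A_ge0 _ _] := evictP A h Ck sC.
by apply: sumr_ge0 => p _; rewrite mulr_ge0.
Qed.

Lemma step_prob_card A h C s C' :
  #|C| = k -> step_prob A h C s C' != 0 -> #|C'| = k.
Proof.
move=> Ck; have [/eqP //|C'k] := boolP (#|C'| == k).
have -> : step_prob A h C s C' = 0; last by rewrite eqxx.
rewrite /step_prob; case: ifPn => sC.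
  by case: eqVneq => // eC; rewrite eC Ck eqxx in C'k.
apply: big1 => p pC; case: eqVneq => [eC|_]; last by rewrite mulr0.
by rewrite eC card_swap // Ck eqxx in C'k.
Qed.

Lemma cost_from_ge0 A h C s t : #|C| = k -> 0 <= cost_from A h C s t.
Proof.
elim: t h C s => [|t IH] h C s Ck; first by rewrite cost_from0.
rewrite cost_fromS //; apply: sumr_ge0 => x _.
rewrite mulr_ge0 ?trans_ge0 // addr_ge0 ?ler0n //; apply: sumr_ge0 => C' _.
(* The induction hypothesis covers only caches of size k; the others have weight 0. *)
have [->|/(step_prob_card Ck) C'k] := eqVneq (step_prob A h C x C') 0.
  by rewrite mul0r.
by rewrite mulr_ge0 ?step_prob_ge0 ?IH.
Qed.

(** * The recursion when the next request is certain *)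

Section Deterministic.
Variables (s y : 'I_n).
Hypothesis next : forall x, M s x = (x == y)%:R.

Lemma cost_from_next A h C t : #|C| = k ->
  cost_from A h C s t.+1 = (y \notin C)%:R +
    \sum_C' step_prob A h C y C' * cost_from A (rcons h (C, y)) C' y t.
Proof.
move=> Ck; rewrite cost_fromS // (bigD1 y) //= next eqxx mul1r.
by rewrite [X in _ + X]big1 ?addr0 // => x /negPf xy; rewrite next xy mul0r.
Qed.

Lemma cost_from_hit A h C t : #|C| = k -> y \in C ->
  cost_from A h C s t.+1 = cost_from A (rcons h (C, y)) C y t.
Proof.
move=> Ck yC; rewrite cost_from_next // yC add0r.
by rewrite (sum_step_hit _ _ _ yC).
Qed.

Lemma cost_from_miss A h C t : #|C| = k -> y \notin C ->
  cost_from A h C s t.+1 = 1 + \sum_(p in C)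
    A h C y p * cost_from A (rcons h (C, y)) (y |: (C :\ p)) y t.
Proof.
move=> Ck yC; rewrite cost_from_next // yC.
by rewrite (sum_step_miss _ _ _ yC).
Qed.

End Deterministic.

End Cost.

(** * The alternating instance and its two algorithms *)

Section Instance.
Context {R : realType}.

(** Page 2 also needs a successor, here 0, but is itself the successor of no page. *)
Definition swap01 (s : 'I_3) : 'I_3 := if s == 0 then 1 else 0.

Definition alternating : 'M[R]_3 := \matrix_(s, x) (x == swap01 s)%:R.

Lemma alternatingP s : distr_on [set: 'I_3] (alternating s).
Proof.
split=> [x|x|]; first by rewrite mxE ler0n.
  by rewrite inE.
rewrite (bigD1 (swap01 s)) ?inE //= mxE eqxx big1 ?addr0 // => x /andP[_ xs].
by rewrite mxE (negPf xs).
Qed.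

Lemma card_setC1_ord3 (c : 'I_3) : #|[set~ c]| = 2%N.
Proof. by rewrite cardsC1 card_ord. Qed.

(** Row 1 as initial distribution makes 0 the first request, as if page 1 had just been requested. A
    cache holds two of three pages, so it is written [[set~ c]] with c the absent page. *)
Definition alternating_paging : markov_paging R 3 2 :=
  MarkovPaging (alternatingP 1) alternatingP (ltn0Sn 1) (card_setC1_ord3 0).

Definition uniform_evict (h : history 3) (C : {set 'I_3}) (s p : 'I_3) : R :=
  if p \in C then 1 / 2 else 0.

Lemma uniform_evictP (h : history 3) (C : {set 'I_3}) (s : 'I_3) :
  #|C| = 2%N -> s \notin C -> distr_on C (uniform_evict h C s).
Proof.
move=> C2 _; rewrite /uniform_evict; split=> [p|p /negPf -> //|].
  by case: ifP => _; lra.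
rewrite (eq_bigr (fun=> 1 / 2)) => [|p ->] //.
by rewrite sumr_const C2; lra.
Qed.

Definition uniform_alg : online_alg R 3 2 := OnlineAlg uniform_evictP.

Lemma cards2_mem (T : finType) (C : {set T}) (q : T) : #|C| = 2%N -> q \in C ->
  exists2 p, p != q & C = [set p; q].
Proof.
move=> /eqP/cards2P[a [b [ab ->]]]; rewrite !inE => /orP[]/eqP->.
  by exists b; rewrite 1?eq_sym // finset.setUC.
by exists a.
Qed.

(** For C = {p, q} the sum is half of [alpha I p q s], since [alpha I q q s] is 0. *)
Lemma dominating_uniform (I : markov_paging R 3 2) : dominating I uniform_alg.
Proof.
move=> h C s C2 _ q qC; have [p pq ->] := cards2_mem C2 qC.
rewrite big_setU1 ?inE //= big_set1 /uniform_evict !inE !eqxx orbT /=.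
have := alpha_le1 I p q s.
have -> : alpha I q q s = 0 by rewrite /alpha eqxx.
lra.
Qed.

(** The uniform fallback supplies a distribution on the cache that lacks page 2, as [online_alg]
    demands. *)
Definition evict2 (h : history 3) (C : {set 'I_3}) (s : 'I_3) : 'I_3 -> R :=
  if (2%:R : 'I_3) \in C then fun p => (p == 2%:R)%:R else uniform_evict h C s.

Lemma evict2P (h : history 3) (C : {set 'I_3}) (s : 'I_3) :
  #|C| = 2%N -> s \notin C -> distr_on C (evict2 h C s).
Proof.
move=> C2 sC; rewrite /evict2; case: ifP => [C_2|_]; last exact: uniform_evictP.
split=> [p|p|]; first exact: ler0n.
  by case: eqP => // ->; rewrite C_2.
rewrite (bigD1 (2%:R : 'I_3)) //= ?eqxx big1 ?addr0 // => p.
by move=> /andP[_ /negPf->].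
Qed.

Definition evict2_alg : online_alg R 3 2 := OnlineAlg evict2P.

Let I := alternating_paging.

Lemma next_request s x : mp_trans I s x = (x == swap01 s)%:R.
Proof. by rewrite mxE. Qed.

Lemma expected_costE A t :
  expected_cost I A t = cost_from I A [::] [set~ swap01 1] 1 t.
Proof. exact: expected_cost_from. Qed.

(** On a miss at c, the evicted page becomes the absent one, so the absent page describes the whole
    cache. *)
Lemma swap_setC1 (c p : 'I_3) : p != c -> c |: ([set~ c] :\ p) = [set~ p].
Proof.
move=> pc; apply/setP => x; rewrite !inE.
by case: (eqVneq x c) => [->|] /=; rewrite ?andbT // eq_sym.
Qed.

Lemma cost_hit A h c s t : swap01 s != c ->
  cost_from I A h [set~ c] s t.+1 =
  cost_from I A (rcons h ([set~ c], swap01 s)) [set~ c] (swap01 s) t.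
Proof.
by move=> sc; rewrite (cost_from_hit (next_request s)) ?card_setC1_ord3 ?inE.
Qed.

Lemma cost_miss A h s t (c := swap01 s) (h' := rcons h ([set~ c], c)) :
  cost_from I A h [set~ c] s t.+1 = 1 + \sum_(p in [set~ c])
    A h [set~ c] c p * cost_from I A h' [set~ p] c t.
Proof.
rewrite (cost_from_miss (next_request s)) ?card_setC1_ord3 ?inE ?negbK //.
congr (_ + _); apply: eq_bigr => p; rewrite !inE => pc.
by rewrite swap_setC1.
Qed.

Lemma cost_miss_ge1 A h s t : 1 <= cost_from I A h [set~ swap01 s] s t.+1.
Proof.
rewrite cost_miss lerDl; apply: sumr_ge0 => p _.
have C2 := card_setC1_ord3 (swap01 s).
have [|A_ge0 _ _] := evictP A h C2 (s := swap01 s); first by rewrite !inE eqxx.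
by rewrite mulr_ge0 // cost_from_ge0 // card_setC1_ord3.
Qed.

(** This cache is {0, 1}, which contains every value of [swap01]. *)
Lemma cost_hit_forever A h s t : cost_from I A h [set~ 2%:R] s t = 0.
Proof.
elim: t h s => [|t IH] h s; first exact: cost_from0.
by rewrite cost_hit ?IH // /swap01; case: ifP.
Qed.

Lemma cost_evict2 t : expected_cost I evict2_alg t.+1 = 1.
Proof.
rewrite expected_costE cost_miss (bigD1 (2%:R : 'I_3)) ?inE //=.
rewrite cost_hit_forever mulr0 add0r big1 ?addr0 // => p /andP[_ p2].
by rewrite /evict2 !inE /= (negPf p2) mul0r.
Qed.

(** The first request is absent from the initial cache, so every algorithm pays at least 1. *)
Lemma evict2_opt t : is_opt I t.+1 evict2_alg.
Proof.
move=> B; rewrite cost_evict2 expected_costE.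
exact: (cost_miss_ge1 B [::] 1 t).
Qed.

Lemma cost_uniform_ge : 7 / 4 <= expected_cost I uniform_alg 3.
Proof.
(* Keep only the branch, of probability 1/2, that evicts the page requested next and so leads to
   another miss; the other branch has nonnegative cost. *)
have evict_next_ge h s t : exists h',
    1 + 1 / 2 * cost_from I uniform_alg h' [set~ swap01 (swap01 s)] (swap01 s) t
    <= cost_from I uniform_alg h [set~ swap01 s] s t.+1.
  exists (rcons h ([set~ swap01 s], swap01 s)).
  have neq : swap01 (swap01 s) != swap01 s by rewrite /swap01; case: (s == 0).
  rewrite cost_miss lerD2l (bigD1 (swap01 (swap01 s))) ?inE //=.
  rewrite {1}/uniform_evict !inE neq lerDl; apply: sumr_ge0 => p _.
  rewrite mulr_ge0 ?cost_from_ge0 ?card_setC1_ord3 //.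
  by rewrite /uniform_evict; case: ifP => _; lra.
rewrite expected_costE.
(* Two such branches and a final forced miss give 1 + 1/2 (1 + 1/2) = 7/4. *)
have [h1] := evict_next_ge [::] 1 2%N.
have [h2] := evict_next_ge h1 (swap01 1) 1%N.
have := cost_miss_ge1 uniform_alg h2 (swap01 (swap01 1)) 0.
lra.
Qed.

End Instance.

Theorem theorem3 (R : realType) :
  exists (n k : nat) (I : markov_paging R n k) (T : nat)
         (Adom OPT : online_alg R n k),
    [/\ dominating I Adom,
        is_opt I T OPT,
        0 < expected_cost I OPT T
      & expected_cost I Adom T >= 15907 / 10000 * expected_cost I OPT T].
Proof.
(* Three requests are taken because two would only give 1 + 1/2, which is below 1.5907. *)
exists 3%N, 2%N, alternating_paging, 3%N, uniform_alg, evict2_alg.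
split; [exact: dominating_uniform | exact: evict2_opt | |].
  by rewrite cost_evict2.
by rewrite cost_evict2; have := @cost_uniform_ge R; lra.
Qed.
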